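(* Let $T$ be a compact subset of $\mathbb{TP}(X)$ and $\gamma\in\mathbb{TP}(X)$ arbitrary. Consider the real-valued functions on $T$: (i) $\Theta^{(T,\gamma)}_\infty:T\to[0,\infty)$, $\alpha\mapsto\Vert\alpha-\gamma\Vert$; (ii) $\underline{\Theta}^{(T,\gamma)}_p:T\to[0,\infty)$ for $p\in[1,\infty)$, $\alpha\mapsto \left(\int_X (h-\inf h)^p\,d\mu\right)^{1/p}$ where $[h]=\alpha-\gamma$; (iii) $\overline{\Theta}^{(T,\gamma)}_p:T\to[0,\infty)$ for $p\in[1,\infty)$, $\alpha\mapsto \left(\int_X (\sup h-h)^p\,d\mu\right)^{1/p}$ where $[h]=\alpha-\gamma$. Then: (1) If $T$ is lower tropically convex, then for each $\gamma\in\mathbb{TP}(X)$ there is a unique element $\underline{\pi}_T(\gamma)\in T$ (the lower tropical projection of $\gamma$ to $T$) which minimizes $\underline{\Theta}^{(T,\gamma)}_p$ for all $p\in[1,\infty)$. Moreover, the minimizer of $\Theta^{(T,\gamma)}_\infty$ is compact and lower tropically convex and contains $\underline{\pi}_T(\gamma)$. (2) If $T$ is upper tropically convex, then for each $\gamma\in\mathbb{TP}(X)$ there is a unique element $\overline{\pi}_T(\gamma)\in T$ (the upper tropical projection of $\gamma$ to $T$) which minimizes $\overline{\Theta}^{(T,\gamma)}_p$ for all $p\in[1,\infty)$. Moreover, the minimizer of $\Theta^{(T,\gamma)}_\infty$ is compact and upper tropically convex and contains $\overline{\pi}_T(\gamma)$. (3) If $T$ is both lower and upper tropically convex, then for each $\gamma\in\mathbb{TP}(X)$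 the minimizer of $\Theta^{(T,\gamma)}_\infty$ is also both lower and upper tropically convex. In addition, $\underline{\pi}_T(\gamma)=\overline{\pi}_T(\gamma)$ if and only if the minimizer of $\Theta^{(T,\gamma)}_\infty$ equals the singleton $\{\underline{\pi}_T(\gamma)\}=\{\overline{\pi}_T(\gamma)\}$.
   Context: $X$ is a locally compact Hausdorff space with a Borel measure $\mu$ such that $\mu(X)\in(0,\infty)$, and such that no $f\in BC(X)$ equals a constant $\mu$-almost everywhere unless $f$ is constant (i.e. the null set ${\mathcal N}(X,\mu)$ is trivial). $BC(X)$ is the space of bounded continuous real functions on $X$, and $\mathbb{TP}(X)=BC(X)/\sim$ where $f\sim g$ iff $f-g$ is constant; $[f]$ denotes the class of $f$. The tropical norm is $\Vert [f]\Vert=\sup f-\inf f$, inducing the metric $\rho(\alpha,\beta)=\Vert\alpha-\beta\Vert$. The lower (resp. upper) tropical segment between $[f]$ and $[g]$ is $\{[\min(a+f,b+g)]: a,b\in\mathbb R\}$ (resp. $\{[\max(a+f,b+g)]: a,b\in\mathbb R\}$). A subset of $\mathbb{TP}(X)$ is lower (resp. upper) tropically convex if it contains the lower (resp. upper) tropical segment between any two of its elements. *)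

(* Defs.v *)
From HB Require Import structures.
From mathcomp Require Import all_boot all_order all_algebra.
From mathcomp Require Import generic_quotient ring_quotient.
From mathcomp Require Import all_classical all_reals all_analysis.

Set Implicit Arguments.
Unset Strict Implicit.
Unset Printing Implicit Defensive.

Import Order.TTheory GRing.Theory Num.Theory.
Import numFieldNormedType.Exports.

Local Open Scope classical_set_scope.
Local Open Scope ring_scope.
Local Open Scope quotient_scope.

Section BoundedContinuous.
Variables (X : ptopologicalType) (R : realType).

(* [mem] with classical membership makes this a boolean predicate, as the
   subtype and closedness structures require. *)
Definition is_BC : {pred (X -> R)} :=
  mem [set f : X -> R | continuous f /\ bounded_fun f].

Record BC := MkBC { BC_fun :> X -> R ; _ : BC_fun \in is_BC }.

HB.instance Definition _ := [isSub for BC_fun].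
HB.instance Definition _ := [Choice of BC by <:].

Lemma bounded_funP (f : X -> R) :
  bounded_fun f <-> exists M, forall x, `|f x| <= M.
Proof.
split=> [[N [_ hN]]|[M hM]].
  by exists (N + 1) => x; apply: (hN (N + 1)); rewrite ?ltrDl.
exists M; split; first exact: num_real.
by move=> N /ltW MN x _ /=; exact: le_trans (hM x) MN.
Qed.

Lemma is_BC_submod_closed : submod_closed is_BC.
Proof.
split=> [|a f g]; rewrite !inE /=.
  by split=> [x|]; [exact: cst_continuous|apply/bounded_funP; exists 0 => x;
    rewrite normr0].
move=> [cf /bounded_funP[M hM]] [cg /bounded_funP[N hN]]; split=> [x|].
  apply: continuousD; last exact: cg.
  by apply: (@continuousM _ _ (fun=> a)); [exact: cst_continuous|exact: cf].
apply/bounded_funP; exists (`|a| * M + N) => x.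
apply: le_trans (ler_normD _ _) _; apply: lerD; last exact: hN.
by rewrite normrM ler_wpM2l.
Qed.

HB.instance Definition _ :=
  GRing.isSubmodClosed.Build _ _ is_BC is_BC_submod_closed.
HB.instance Definition _ := [SubChoice_isSubLmodule of BC by <:].

Lemma BC_continuous (f : BC) : continuous f.
Proof. by have := valP f; rewrite inE => -[]. Qed.

Lemma BC_bounded (f : BC) : exists M, forall x, `|f x| <= M.
Proof. by have := valP f; rewrite inE => -[_ /bounded_funP]. Qed.

Lemma BC_const_subproof (c : R) : (fun _ : X => c) \in is_BC.
Proof.
rewrite inE; split=> [x|]; first exact: cst_continuous.
by apply/bounded_funP; exists `|c|.
Qed.

Definition BC_const (c : R) : BC := MkBC (BC_const_subproof c).

Lemma BC_min_subproof (f g : BC) :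
  (fun x => Num.min (f x) (g x)) \in is_BC.
Proof.
rewrite inE; split=> [x|].
  by apply: continuous_min; exact: BC_continuous.
have [[M hM] [N hN]] := (BC_bounded f, BC_bounded g).
apply/bounded_funP; exists (Num.max M N) => x.
by rewrite le_max /Num.min; case: ifP => _; rewrite ?hM ?hN ?orbT.
Qed.

Definition BC_min (f g : BC) : BC := MkBC (BC_min_subproof f g).

Lemma BC_max_subproof (f g : BC) :
  (fun x => Num.max (f x) (g x)) \in is_BC.
Proof.
rewrite inE; split=> [x|].
  by apply: continuous_max; exact: BC_continuous.
have [[M hM] [N hN]] := (BC_bounded f, BC_bounded g).
apply/bounded_funP; exists (Num.max M N) => x.
by rewrite le_max /Num.max; case: ifP => _; rewrite ?hM ?hN ?orbT.
Qed.

Definition BC_max (f g : BC) : BC := MkBC (BC_max_subproof f g).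

Definition is_const : {pred BC} :=
  mem [set f : BC | exists c : R, forall x, f x = c].

Lemma is_const_submod_closed : submod_closed is_const.
Proof.
split=> [|a f g]; rewrite !inE /=; first by exists 0.
by move=> [c fc] [d gd]; exists (a * c + d) => x /=; rewrite -(fc x) -(gd x).
Qed.

HB.instance Definition _ :=
  GRing.isSubmodClosed.Build _ _ is_const is_const_submod_closed.

Lemma BC_has_ubound (f : BC) : has_ubound (range f).
Proof.
have [M hM] := BC_bounded f; exists M => _ [x _ <-].
exact: le_trans (ler_norm _) (hM x).
Qed.

Lemma BC_has_lbound (f : BC) : has_lbound (range f).
Proof.
have [M hM] := BC_bounded f; exists (- M) => _ [x _ <-].
by rewrite lerNl (le_trans _ (hM x))// -normrN ler_norm.
Qed.

Lemma BC_range_neq0 (f : BC) : range f !=set0.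
Proof. by exists (f point); exists point. Qed.

Lemma BC_le_sup (f : BC) x : f x <= sup (range f).
Proof. by apply: ub_le_sup; [exact: BC_has_ubound|exists x]. Qed.

Lemma BC_inf_le (f : BC) x : inf (range f) <= f x.
Proof. by apply: ge_inf; [exact: BC_has_lbound|exists x]. Qed.

Lemma BC_sup_le (f : BC) (M : R) : (forall x, f x <= M) -> sup (range f) <= M.
Proof.
by move=> h; apply: ge_sup; [exact: BC_range_neq0|move=> _ [x _ <-]].
Qed.

Lemma BC_le_inf (f : BC) (M : R) : (forall x, M <= f x) -> M <= inf (range f).
Proof.
by move=> h; apply: lb_le_inf; [exact: BC_range_neq0|move=> _ [x _ <-]].
Qed.

Lemma BC_supD (f g : BC) (c : R) : (forall x, f x = g x + c) ->
  sup (range f) = sup (range g) + c.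
Proof.
move=> fg; apply/eqP; rewrite eq_le -lerBrDr; apply/andP; split.
  by apply: BC_sup_le => x; rewrite fg lerD2r BC_le_sup.
by apply: BC_sup_le => x; rewrite lerBrDr -fg BC_le_sup.
Qed.

Lemma BC_infD (f g : BC) (c : R) : (forall x, f x = g x + c) ->
  inf (range f) = inf (range g) + c.
Proof.
move=> fg; apply/eqP; rewrite eq_le -lerBlDr; apply/andP; split.
  by apply: BC_le_inf => x; rewrite lerBlDr -fg BC_inf_le.
by apply: BC_le_inf => x; rewrite fg lerD2r BC_inf_le.
Qed.

End BoundedContinuous.

Arguments BC_const {X R} c.

Section TropicalProjectiveSpace.
Variables (X : ptopologicalType) (R : realType).
Implicit Types (f g h : BC X R).

Definition TP : Type := Quotient.quot (@is_const X R).

HB.instance Definition _ := GRing.Zmodule.on TP.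
HB.instance Definition _ := Quotient.on TP.

Definition cls f : TP := \pi_TP f.

Lemma clsP f g : cls f = cls g <-> exists c : R, forall x, f x - g x = c.
Proof.
split.
  move/eqP; rewrite /cls -(Quotient.idealrBE (@is_const X R)) inE => -[c fg].
  by exists c.
move=> [c fg]; apply/eqP; rewrite /cls -(Quotient.idealrBE (@is_const X R)).
by rewrite inE; exists c.
Qed.

Lemma cls_repr (a : TP) : cls (repr a) = a.
Proof. exact: reprK. Qed.

Lemma clsD f g : cls (f + g) = cls f + cls g.
Proof. by rewrite /cls !piE. Qed.

Lemma repr_cls f : exists c : R, forall x, repr (cls f) x = f x + c.
Proof.
have /clsP[c h] := cls_repr (cls f).
by exists c => x; rewrite -(h x) addrC subrK.
Qed.

Definition TP_scale (a : R) (u : TP) : TP := cls (a *: repr u).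

Lemma TP_scaleE (a : R) f : TP_scale a (cls f) = cls (a *: f).
Proof.
have [c h] := repr_cls f; apply/clsP; exists (a * c) => x.
by rewrite /= -mulrBr h addrAC subrr add0r.
Qed.

Lemma TP_scaleA a b (u : TP) : TP_scale a (TP_scale b u) = TP_scale (a * b) u.
Proof. by rewrite -[u]cls_repr !TP_scaleE scalerA. Qed.

Lemma TP_scale1 : left_id 1 TP_scale.
Proof. by move=> u; rewrite -[u]cls_repr TP_scaleE scale1r. Qed.

Lemma TP_scaleDr : right_distributive TP_scale +%R.
Proof.
move=> a u v; rewrite -[u]cls_repr -[v]cls_repr -clsD !TP_scaleE -clsD.
by rewrite scalerDr.
Qed.

Lemma TP_scaleDl v : {morph TP_scale^~ v : a b / a + b}.
Proof.
by move=> a b /=; rewrite -[v]cls_repr !TP_scaleE -clsD scalerDl.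
Qed.

HB.instance Definition _ := GRing.Zmodule_isLmodule.Build R TP
  TP_scaleA TP_scale1 TP_scaleDr TP_scaleDl.

Definition TP_norm (u : TP) : R :=
  sup (range (repr u : X -> R)) - inf (range (repr u : X -> R)).

Lemma TP_norm_cls f : TP_norm (cls f) = sup (range f) - inf (range f).
Proof.
have [c h] := repr_cls f.
by rewrite /TP_norm (BC_supD h) (BC_infD h) opprD addrACA subrr addr0.
Qed.

Lemma TP_norm_ge f x y : f x - f y <= TP_norm (cls f).
Proof. by rewrite TP_norm_cls lerB ?BC_le_sup ?BC_inf_le. Qed.

Lemma TP_norm_le f (M : R) :
  (forall x y, f x - f y <= M) -> TP_norm (cls f) <= M.
Proof.
move=> h; rewrite TP_norm_cls lerBlDl; apply: BC_sup_le => x.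
by rewrite -lerBlDr; apply: BC_le_inf => y; rewrite lerBlDr -lerBlDl.
Qed.

Lemma TP_norm_ge0 (u : TP) : 0 <= TP_norm u.
Proof. by have := TP_norm_ge (repr u) point point; rewrite subrr cls_repr. Qed.

Lemma TP_ler_normD (u v : TP) : TP_norm (u + v) <= TP_norm u + TP_norm v.
Proof.
rewrite -[u]cls_repr -[v]cls_repr -clsD; apply: TP_norm_le => x y /=.
by rewrite opprD addrACA lerD// TP_norm_ge.
Qed.

Lemma TP_normrZ (a : R) (u : TP) : TP_norm (a *: u) = `|a| * TP_norm u.
Proof.
have H b v : TP_norm (b *: v) <= `|b| * TP_norm v.
  rewrite -[v]cls_repr [_ *: _]TP_scaleE; apply: TP_norm_le => x y /=.
  rewrite -scalerBr; apply: le_trans (ler_norm _) _.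
  rewrite normrM ler_wpM2l// ler_norml TP_norm_ge andbT.
  by rewrite lerNl opprB TP_norm_ge.
have [->|a0] := eqVneq a 0.
  rewrite normr0 mul0r; apply/eqP; rewrite eq_le TP_norm_ge0 andbT.
  by rewrite (le_trans (H _ _))// normr0 mul0r.
apply/eqP; rewrite eq_le H /= -ler_pdivlMl ?normr_gt0// -normfV.
by apply: le_trans (H _ _); rewrite scalerA mulVf// scale1r.
Qed.

Lemma TP_norm_eq0 (u : TP) : TP_norm u = 0 -> u = 0.
Proof.
rewrite -[u]cls_repr TP_norm_cls => /eqP; rewrite subr_eq0 => /eqP E.
have -> : 0 = cls 0 by rewrite /cls !piE.
apply/clsP; exists (sup (range (repr u : X -> R))) => x /=.
by rewrite subr0; apply/eqP; rewrite eq_le BC_le_sup /= E BC_inf_le.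
Qed.

HB.instance Definition _ := @Lmodule_isNormed.Build R TP
  TP_norm TP_ler_normD TP_normrZ TP_norm_eq0.

End TropicalProjectiveSpace.

Section TropicalConvexity.
Variables (X : ptopologicalType) (R : realType).
Implicit Types (f g : BC X R) (u v : TP X R) (T : set (TP X R)).

Definition lower_segment u v : set (TP X R) :=
  [set w | exists f g (a b : R), [/\ cls f = u, cls g = v &
    w = cls (BC_min (BC_const a + f) (BC_const b + g))]].

Definition upper_segment u v : set (TP X R) :=
  [set w | exists f g (a b : R), [/\ cls f = u, cls g = v &
    w = cls (BC_max (BC_const a + f) (BC_const b + g))]].

Lemma clsDconst f (c : R) : cls (BC_const c + f) = cls f.
Proof. by apply/clsP; exists c => x /=; rewrite addrK. Qed.

Lemma cls_eqD f g : cls f = cls g -> exists c : R, f = BC_const c + g.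
Proof.
by move=> /clsP[c fg]; exists c; apply/val_inj/funext => x; apply/eqP; rewrite /= -subr_eq; apply/eqP/fg.
Qed.

Lemma BC_constD (a b : R) : BC_const a + BC_const b = BC_const (a + b) :> BC X R.
Proof. exact/val_inj/funext. Qed.

Lemma lower_segment_cls f g :
  lower_segment (cls f) (cls g) =
  [set w | exists a b : R, w = cls (BC_min (BC_const a + f) (BC_const b + g))].
Proof.
apply/seteqP; split=> w /=; last by move=> [a [b ->]]; exists f, g, a, b.
move=> [f' [g' [a [b [/cls_eqD[c ->] /cls_eqD[d ->] ->]]]]].
by exists (a + c), (b + d); rewrite !addrA !BC_constD.
Qed.

Lemma upper_segment_cls f g :
  upper_segment (cls f) (cls g) =
  [set w | exists a b : R, w = cls (BC_max (BC_const a + f) (BC_const b + g))].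
Proof.
apply/seteqP; split=> w /=; last by move=> [a [b ->]]; exists f, g, a, b.
move=> [f' [g' [a [b [/cls_eqD[c ->] /cls_eqD[d ->] ->]]]]].
by exists (a + c), (b + d); rewrite !addrA !BC_constD.
Qed.

Definition lower_convex T := forall u v, T u -> T v -> lower_segment u v `<=` T.

Definition upper_convex T := forall u v, T u -> T v -> upper_segment u v `<=` T.

End TropicalConvexity.

Notation borel X := (g_sigma_algebraType (@open X)).

Section Projections.
Variables (X : ptopologicalType) (R : realType).
Variable mu : {measure set (borel X) -> \bar R}.
Implicit Types (gamma u : TP X R) (T : set (TP X R)) (p : R).

Definition trivial_null_set : Prop :=
  forall f : BC X R, (exists c : R, {ae mu, forall x, f x = c}) ->
    exists c : R, forall x, f x = c.

Definition theta_oo gamma u : R := `|u - gamma|.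

(* The integrands below are unchanged when a constant is added to [h], so the
   choice of representative made by [repr] is immaterial: see [lower_thetaE]
   and [upper_thetaE]. *)
Definition lower_theta p gamma u : R :=
  let h : X -> R := repr (u - gamma) in
  (\int[mu]_x (h x - inf (range h)) `^ p) `^ p^-1.

Definition upper_theta p gamma u : R :=
  let h : X -> R := repr (u - gamma) in
  (\int[mu]_x (sup (range h) - h x) `^ p) `^ p^-1.

Lemma lower_thetaE p gamma u (h : BC X R) : cls h = u - gamma ->
  lower_theta p gamma u = (\int[mu]_x (h x - inf (range h)) `^ p) `^ p^-1.
Proof.
move=> hu; have [c hc] := repr_cls h; rewrite /lower_theta -hu (BC_infD hc).
by congr (_ `^ _); apply: eq_Rintegral => x _; rewrite hc opprD addrACA subrr addr0.
Qed.

Lemma upper_thetaE p gamma u (h : BC X R) : cls h = u - gamma ->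
  upper_theta p gamma u = (\int[mu]_x (sup (range h) - h x) `^ p) `^ p^-1.
Proof.
move=> hu; have [c hc] := repr_cls h; rewrite /upper_theta -hu (BC_supD hc).
by congr (_ `^ _); apply: eq_Rintegral => x _; rewrite hc opprD addrACA subrr addr0.
Qed.

Definition minimizer T (Theta : TP X R -> R) : set (TP X R) :=
  [set u | T u /\ forall v, T v -> Theta u <= Theta v].

Definition is_lower_projection T gamma u : Prop :=
  forall p, 1 <= p -> minimizer T (lower_theta p gamma) u.

Definition is_upper_projection T gamma u : Prop :=
  forall p, 1 <= p -> minimizer T (upper_theta p gamma) u.

End Projections.

(* Main.v *)
(* Represent [u - gamma] by its representative with infimum 0, its excess.
   Lower convexity of [T] makes the set of excesses closed under pointwise
   minima, so compactness yields a pointwise least one.  It minimizes every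
   p-functional and also the sup-norm functional.  Conversely, any p-minimizer
   agrees with the least excess almost everywhere, hence everywhere because the
   null set is trivial.  Negation exchanges the lower and upper cases.  If the
   two projections coincide in [u], a minimizer [w] of the sup-norm functional
   has the same norm [m] as [u], and its excess [h_w] satisfies both
   [h_u <= h_w] and [m - h_u <= m - h_w], whence [w = u]. *)
Require Import Defs.
From HB Require Import structures.
From mathcomp Require Import all_boot all_order all_algebra.
From mathcomp Require Import all_classical all_reals all_analysis.
From mathcomp Require Import measurable_realfun lra.

Set Implicit Arguments.
Unset Strict Implicit.
Unset Printing Implicit Defensive.

Import Order.TTheory GRing.Theory Num.Theory.
Import numFieldNormedType.Exports.

Local Open Scope classical_set_scope.
Local Open Scope ring_scope.

(** * Representatives with infimum zero *)

Section Excess.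
Variables (X : ptopologicalType) (R : realType).
Implicit Types (f g : BC X R) (u v w gamma : TP X R) (T : set (TP X R)).

Lemma clsB f g : cls (f - g) = cls f - cls g.
Proof. by apply/esym/eqP; rewrite subr_eq -clsD subrK. Qed.

Lemma clsN f : cls (- f) = - cls f.
Proof. by rewrite -[- f]add0r clsB -[in cls 0](subrr f) clsB subrr add0r. Qed.

Definition excess w : BC X R :=
  BC_const (- inf (range (repr w : X -> R))) + repr w.

Lemma cls_excess w : cls (excess w) = w.
Proof. by rewrite clsDconst cls_repr. Qed.

Lemma inf_excess w : inf (range (excess w)) = 0.
Proof.
rewrite (@BC_infD _ _ (excess w) (repr w) (- inf (range (repr w : X -> R)))).
  by rewrite subrr.
by move=> x; rewrite addrC.
Qed.

Lemma excess_ge0 w x : 0 <= excess w x.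
Proof. by rewrite -(inf_excess w) BC_inf_le. Qed.

Lemma excess_cls f : inf (range f) = 0 -> excess (cls f) = f.
Proof.
move=> f0.
have /clsP[c fc] : cls (excess (cls f)) = cls f by rewrite cls_excess.
have fE x : excess (cls f) x = f x + c by rewrite -(fc x) addrC subrK.
have := BC_infD fE; rewrite inf_excess f0 add0r => c0.
by apply/val_inj/funext => x /=; rewrite [LHS]fE -c0 addr0.
Qed.

Lemma excess_eq u v (c : R) : (forall x, excess u x - excess v x = c) -> u = v.
Proof.
by move=> uv; rewrite -[u]cls_excess -[v]cls_excess; apply/clsP; exists c.
Qed.

Lemma normTPE w : `|w| = sup (range (excess w)).
Proof.
by rewrite -{1}[w]cls_excess [LHS]TP_norm_cls inf_excess subr0.
Qed.

Lemma normTP_clsB f g x y : (f x - g x) - (f y - g y) <= `|cls f - cls g|.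
Proof. by rewrite -clsB; apply: (TP_norm_ge (f - g)). Qed.

Lemma BC_infN f : inf (range (- f : BC X R)) = - sup (range f).
Proof.
apply/eqP; rewrite eq_le lerNr; apply/andP; split.
  by apply: BC_sup_le => x; rewrite lerNr; exact: (BC_inf_le (- f) x).
by apply: BC_le_inf => x; rewrite lerN2 BC_le_sup.
Qed.

(** Since [excess w] has infimum 0 and supremum [|w|], the function [|w| - excess w] represents
    [- w] and again has infimum 0. This is what lets negation exchange the lower and upper cases. *)
Lemma excessN w x : excess (- w) x = `|w| - excess w x.
Proof.
have -> : - w = cls (BC_const `|w| - excess w).
  by rewrite clsDconst clsN cls_excess.
rewrite excess_cls//; rewrite (@BC_infD _ _ _ (- excess w) `|w|).
  by rewrite BC_infN normTPE addNr.
by move=> y; exact: addrC.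
Qed.

Lemma le_norm_excess u v :
  (forall x, excess u x <= excess v x) -> `|u| <= `|v|.
Proof.
move=> uv; rewrite !normTPE; apply: BC_sup_le => x.
exact: le_trans (uv x) (BC_le_sup _ x).
Qed.

(** Evaluation of the excess at a point is 1-Lipschitz, which makes pointwise bounds on excesses
    closed conditions. *)
Lemma excess_le_dist u v x : excess u x <= excess v x + `|u - v|.
Proof.
(* The oscillation of [excess u - excess v] between [x] and [y] is at most [|u - v|]. Dropping
   [excess v y >= 0] leaves a lower bound for [excess u] that does not depend on [y], hence one for
   its infimum 0. *)
have uv y : excess u x - excess v x - `|u - v| + excess v y <= excess u y.
  have := normTP_clsB (excess u) (excess v) x y; rewrite !cls_excess.
  by rewrite lerBlDr -lerBlDl lerBrDr.
rewrite -subr_le0 opprD addrA -(inf_excess u); apply: BC_le_inf => y.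
by apply: le_trans (uv y); rewrite lerDl excess_ge0.
Qed.

(** * Minima of excesses and the least excess *)

Lemma excess_min u v :
  excess (cls (BC_min (excess u) (excess v))) = BC_min (excess u) (excess v).
Proof.
apply: excess_cls; apply/eqP; rewrite eq_le; apply/andP; split; last first.
  by apply: BC_le_inf => x; rewrite /= le_min !excess_ge0.
rewrite -(inf_excess u); apply: BC_le_inf => x.
by apply: le_trans (BC_inf_le _ x) _; rewrite /= ge_min lexx.
Qed.

(** Adding [repr gamma] commutes with pointwise minima, so the required element is the point of the
    lower segment from [u] to [v] with both constants 0, for the representatives shifted by
    [repr gamma]. *)
Lemma lower_convex_min T gamma u v : lower_convex T -> T u -> T v ->
  exists2 w, T w &
    excess (w - gamma) = BC_min (excess (u - gamma)) (excess (v - gamma)).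
Proof.
move=> Tconv Tu Tv; set m := BC_min _ _; exists (cls m + gamma); last first.
  by rewrite addrK excess_min.
apply: (Tconv _ _ Tu Tv).
exists (excess (u - gamma) + repr gamma), (excess (v - gamma) + repr gamma).
exists 0, 0.
have E w : cls (excess (w - gamma) + repr gamma) = w.
  by rewrite clsD cls_excess cls_repr subrK.
split=> //.
rewrite (_ : _ + gamma = cls (m + repr gamma)); last by rewrite clsD cls_repr.
congr cls; apply/val_inj/funext => x; apply: etrans (addr_minl _ _ _) _.
by congr Num.min; exact: esym (add0r _).
Qed.

Lemma closed_excess_le gamma f :
  closed [set u | forall x, excess (u - gamma) x <= f x].
Proof.
move=> u clu x; apply/ler_addgt0Pr => e e0.
have [v [/= vf]] := clu _ (nbhsx_ballx u e e0).
rewrite -ball_normE /= => /ltW uv.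
apply: le_trans (excess_le_dist _ (v - gamma) x) _.
apply: lerD; first exact: vf.
by rewrite opprD addrACA subrr addr0.
Qed.

(* The sets [C v] of elements below [v] form a filter base, since [T] is closed
   under minima; a cluster point lies below every [v]. *)
Lemma least_excess T gamma : T !=set0 -> compact T -> lower_convex T ->
  exists2 u, T u &
    forall v, T v -> forall x, excess (u - gamma) x <= excess (v - gamma) x.
Proof.
move=> [t0 Tt0] cT Tconv.
pose C v :=
  T `&` [set u | forall x, excess (u - gamma) x <= excess (v - gamma) x].
have FC : ProperFilter (filter_from T C).
  apply: filter_from_proper; last by move=> v Tv; exists v; split=> /=.
  apply: filter_from_filter => [|v v' Tv Tv']; first by exists t0.
  have [w Tw wE] := lower_convex_min gamma Tconv Tv Tv'.
  exists w => // u [Tu]; rewrite wE /= => uw.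
  by split; split=> //= x; have := uw x; rewrite le_min => /andP[].
have [|u [Tu clu]] := cT (filter_from T C) => //; first by exists t0 => // u [].
exists u => // v Tv; apply: closed_excess_le => B uB.
have [w [[_ Cw] Bw]] : C v `&` B !=set0 by apply: clu => //; exists v.
by exists w.
Qed.

(** * Minimizers of the sup-norm functional *)

(** Balls are lower convex: at [y] the minimum is attained by one of the two branches, and at [x] it
    is at most that same branch, so its oscillation relative to [gamma] is bounded by that of a
    single endpoint. *)
Lemma lower_segment_dist u v w gamma (m : R) : lower_segment u v w ->
  `|u - gamma| <= m -> `|v - gamma| <= m -> `|w - gamma| <= m.
Proof.
move=> [f [g [a [b [<- <- ->]]]]]; rewrite -[gamma]cls_repr.
move: (repr gamma) => h fm gm; rewrite -clsB; apply: TP_norm_le => x y.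
have fxy := le_trans (normTP_clsB f h x y) fm.
have gxy := le_trans (normTP_clsB g h x y) gm.
change (Num.min (a + f x) (b + g x) - h x
  - (Num.min (a + f y) (b + g y) - h y) <= m).
have [lef leg] : Num.min (a + f x) (b + g x) <= a + f x /\
  Num.min (a + f x) (b + g x) <= b + g x by rewrite !ge_min !lexx orbT.
by case: (leP (a + f y) (b + g y)) => _; lra.
Qed.

Lemma minimizer_oo_compact T gamma :
  compact T -> compact (minimizer T (theta_oo gamma)).
Proof.
move=> cT; have [->|/set0P[u [Tu umin]]] :=
  eqVneq (minimizer T (theta_oo gamma)) set0; first exact: compact0.
(* A nonempty minimizer is the part of [T] in the closed ball around [gamma] whose radius is the
   minimal value. *)
suff -> : minimizer T (theta_oo gamma) =
    T `&` closed_ball_ Num.norm gamma `|u - gamma|.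
  by apply: compact_closedI => //; exact: closed_closed_ball_.
apply/seteqP; split=> v /= [Tv vmin]; split=> //.
  by rewrite /closed_ball_ /= distrC; exact: vmin.
move=> v' /umin; apply: le_trans.
by move: vmin; rewrite /closed_ball_ /= distrC.
Qed.

Lemma minimizer_oo_lower_convex T gamma :
  lower_convex T -> lower_convex (minimizer T (theta_oo gamma)).
Proof.
move=> Tconv u v [Tu umin] [Tv vmin] w uvw; split; first exact: Tconv uvw.
move=> t Tt; apply: lower_segment_dist uvw _ _; [exact: umin|exact: vmin].
Qed.

(** * Duality under negation *)

Lemma upper_segmentN u v w :
  upper_segment u v w -> lower_segment (- u) (- v) (- w).
Proof.
move=> [f [g [a [b [<- <- ->]]]]].
exists (- f), (- g), (- a), (- b); split=> //; rewrite -clsN; congr cls.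
apply/val_inj/funext => x; apply: etrans (oppr_max _ _) _.
by congr Num.min; exact: opprD.
Qed.

Lemma lower_segmentN u v w :
  lower_segment u v w -> upper_segment (- u) (- v) (- w).
Proof.
move=> [f [g [a [b [<- <- ->]]]]].
exists (- f), (- g), (- a), (- b); split=> //; rewrite -clsN; congr cls.
apply/val_inj/funext => x; apply: etrans (oppr_min _ _) _.
by congr Num.max; exact: opprD.
Qed.

Lemma image_oppTP T u : (-%R @` T) u <-> T (- u).
Proof.
by split=> [[v Tv <-]|Tu]; [rewrite opprK|exists (- u); rewrite ?opprK].
Qed.

Lemma upper_convexN T : upper_convex T -> lower_convex (-%R @` T).
Proof.
move=> Tconv u v /image_oppTP Tu /image_oppTP Tv w /lower_segmentN uvw.
by apply/image_oppTP; exact: Tconv uvw.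
Qed.

Lemma lower_convexN T : lower_convex (-%R @` T) -> upper_convex T.
Proof.
move=> Tconv u v Tu Tv w /upper_segmentN uvw.
rewrite -[w]opprK; apply/image_oppTP.
by apply: Tconv uvw; apply/image_oppTP; rewrite opprK.
Qed.

Lemma minimizerN T (F G : TP X R -> R) : (forall u, G (- u) = F u) ->
  minimizer (-%R @` T) G = -%R @` minimizer T F.
Proof.
move=> GF; apply/seteqP; split=> u.
  move=> [/image_oppTP Tu umin]; apply/image_oppTP; split=> // v Tv.
  by rewrite -!GF opprK; apply: umin; apply/image_oppTP; rewrite opprK.
move=> /image_oppTP [Tu umin]; split; first exact/image_oppTP.
by move=> v /image_oppTP /umin; rewrite -!GF !opprK.
Qed.

Lemma theta_ooN gamma u : theta_oo (- gamma) (- u) = theta_oo gamma u.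
Proof. by rewrite /theta_oo -opprD normrN. Qed.

Lemma minimizer_oo_upper_convex T gamma :
  upper_convex T -> upper_convex (minimizer T (theta_oo gamma)).
Proof.
move=> /upper_convexN Tconv; apply: lower_convexN.
by rewrite -(minimizerN _ (theta_ooN gamma)); exact: minimizer_oo_lower_convex.
Qed.
End Excess.

(** * Integrals of powers of bounded continuous functions *)

Section Integrals.
Variables (X : ptopologicalType) (R : realType).
Variable mu : {measure set (borel X) -> \bar R}.
Hypothesis mu_lty : (mu [set: X] < +oo)%E.
Implicit Types (f g : BC X R) (p : R).

Lemma measurable_BC f : measurable_fun [set: borel X] (f : borel X -> R).
Proof.
apply: (measurability _ (RGenOpens.measurableE R)).
move=> _ [_ [a [b ->] <-]]; rewrite setTI; apply: sub_sigma_algebra.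
have /continuousP cf := @BC_continuous _ _ f.
by apply: cf; exact: interval_open.
Qed.

Lemma integrable_powR f p : (forall x, 0 <= f x) -> 0 <= p ->
  mu.-integrable [set: borel X] (EFin \o (fun x => f x `^ p)).
Proof.
move=> f0 p0; apply: measurable_bounded_integrable => //.
  apply: (measurableT_comp (f := @powR R ^~ p)); first exact: measurable_powR.
  exact: measurable_BC.
have [M fM] := BC_bounded f; exists (M `^ p); split; first exact: num_real.
move=> N MN x _; apply: le_trans (ltW MN); rewrite ger0_norm ?powR_ge0//.
have fxM : f x <= M by exact: le_trans (ler_norm _) (fM x).
by apply: ge0_ler_powR; rewrite ?nnegrE// (le_trans (f0 x)).
Qed.

Lemma le_integral_powR f g p : (forall x, 0 <= f x <= g x) -> 0 <= p ->
  \int[mu]_x (f x `^ p) <= \int[mu]_x (g x `^ p).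
Proof.
move=> fg p0; have f0 x : 0 <= f x by case/andP: (fg x).
have g0 x : 0 <= g x by case/andP: (fg x); exact: le_trans.
apply: le_Rintegral; [exact: measurableT|exact: integrable_powR..|].
move=> x _; apply: ge0_ler_powR; rewrite ?nnegrE//.
by case/andP: (fg x).
Qed.

(** The nonnegative difference of the powers has integral zero, so it vanishes almost everywhere,
    and the [p]-th power is injective on nonnegative reals. *)
Lemma ae_eq_integral_powR f g p : (forall x, 0 <= f x <= g x) -> 0 < p ->
  \int[mu]_x (f x `^ p) = \int[mu]_x (g x `^ p) -> {ae mu, forall x, f x = g x}.
Proof.
move=> fg p0 fgE; have f0 x : 0 <= f x by case/andP: (fg x).
have g0 x : 0 <= g x by case/andP: (fg x); exact: le_trans.
have [If Ig] := (integrable_powR f0 (ltW p0), integrable_powR g0 (ltW p0)).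
pose d (x : borel X) := g x `^ p - f x `^ p.
have d0 x : 0 <= d x.
  rewrite subr_ge0; apply: (ge0_ler_powR (ltW p0)); rewrite ?nnegrE//.
  by case/andP: (fg x).
have Id : mu.-integrable setT (EFin \o d).
  by rewrite /comp; under eq_fun do rewrite EFinB; exact: integrableB.
have : (\int[mu]_x `|(d x)%:E| = 0)%E.
  rewrite (eq_integral (fun x => (d x)%:E)); last first.
    by move=> x _; rewrite gee0_abs// lee_fin d0.
  (* Integrability makes the extended integral finite, so it suffices that its real value
     vanishes. *)
  rewrite -[LHS]fineK; last exact: integrable_fin_num.
  by rewrite -/(Rintegral mu setT d) RintegralB// fgE subrr.
move/ae_eq_integral_abs => /(_ measurableT (measurable_int _ Id)).
apply: filterS => x /(_ I) dx0.
have /eqP : d x = 0 by exact: EFin_inj dx0.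
rewrite subr_eq0 => /eqP gfx; apply/esym.
by apply: (powR_injective p0); rewrite ?inE ?nnegrE.
Qed.

End Integrals.

(** * Lower projections as least elements *)

Section Projections.
Variables (X : ptopologicalType) (R : realType).
Variable mu : {measure set (borel X) -> \bar R}.
Hypothesis mu_lty : (mu [set: X] < +oo)%E.
Hypothesis mu_null : trivial_null_set mu.
Implicit Types (u v w gamma : TP X R) (T : set (TP X R)) (p : R).

Lemma lower_theta_excess p gamma u :
  lower_theta mu p gamma u = (\int[mu]_x (excess (u - gamma) x `^ p)) `^ p^-1.
Proof.
rewrite (lower_thetaE mu p (cls_excess (u - gamma))) inf_excess.
by congr (_ `^ _); apply: eq_Rintegral => x _; rewrite subr0.
Qed.

(** A description of the lower projection that involves neither [p] nor [mu]; see
    [lower_projectionP]. *)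
Definition is_least T gamma u :=
  T u /\ forall v, T v -> forall x, excess (u - gamma) x <= excess (v - gamma) x.

Lemma least_minimizer T gamma u p : is_least T gamma u -> 1 <= p ->
  minimizer T (lower_theta mu p gamma) = [set u].
Proof.
move=> [Tu umin] p1; have p0 : 0 < p by exact: lt_le_trans p1.
have uv v : T v -> forall x, 0 <= excess (u - gamma) x <= excess (v - gamma) x.
  by move=> Tv x; rewrite excess_ge0 umin.
have le_uv v : T v ->
    \int[mu]_x (excess (u - gamma) x `^ p) <=
    \int[mu]_x (excess (v - gamma) x `^ p).
  by move=> Tv; apply: le_integral_powR (ltW p0) => //; exact: uv.
have I0 v : 0 <= \int[mu]_x (excess (v - gamma) x `^ p).
  by apply: Rintegral_ge0 => x _; exact: powR_ge0.
have theta_uv v : T v -> lower_theta mu p gamma u <= lower_theta mu p gamma v.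
  move=> Tv; rewrite !lower_theta_excess.
  apply: ge0_ler_powR; last exact: le_uv.
  - by rewrite invr_ge0 ltW.
  - by rewrite nnegrE; exact: I0.
  - by rewrite nnegrE; exact: I0.
apply/seteqP; split=> [v [Tv vmin]|_ ->]; last by split.
have : lower_theta mu p gamma u = lower_theta mu p gamma v.
  by apply: le_anti; apply/andP; split; [exact: theta_uv|exact: vmin].
rewrite !lower_theta_excess => theta_eq.
have pV0 : 0 < p^-1 by rewrite invr_gt0.
have uv_ae := ae_eq_integral_powR mu_lty (uv v Tv) p0
  (powR_injective pV0 (I0 u) (I0 v) theta_eq).
(* The difference of the excesses is almost everywhere equal to 0, so triviality of the null set
   makes it constant; excesses that differ by a constant come from the same class. *)
have [|c vu] := mu_null (f := excess (v - gamma) - excess (u - gamma)).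
  have [N [mN N0 subN]] := uv_ae; exists 0, N; split; [exact: mN|exact: N0|].
  move=> x nx; apply: subN => uvx; apply: nx.
  transitivity (excess (v - gamma) x - excess (u - gamma) x); first by [].
  by rewrite uvx; exact: subrr.
by apply: (addIr (- gamma)); exact: excess_eq vu.
Qed.

(** A least element exists and is the only minimizer for every [p]; the forward direction needs only
    the exponent 1. *)
Lemma lower_projectionP T gamma u : T !=set0 -> compact T -> lower_convex T ->
  is_lower_projection mu T gamma u <-> is_least T gamma u.
Proof.
move=> T0 cT Tconv; split=> [uproj|ul p p1]; last first.
  by rewrite (least_minimizer ul).
have [v Tv vmin] := least_excess gamma T0 cT Tconv.
have vl : is_least T gamma v by [].
by have := uproj 1 (lexx _); rewrite (least_minimizer vl)// => ->.
Qed.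

Lemma least_theta_oo T gamma u :
  is_least T gamma u -> minimizer T (theta_oo gamma) u.
Proof. by move=> [Tu umin]; split=> // v /umin; exact: le_norm_excess. Qed.

Lemma lower_projection_spec T gamma :
  T !=set0 -> compact T -> lower_convex T ->
  [/\ exists! u, is_lower_projection mu T gamma u,
      forall u, is_lower_projection mu T gamma u ->
        forall p : R, 1 <= p -> minimizer T (lower_theta mu p gamma) = [set u],
      compact (minimizer T (theta_oo gamma)),
      lower_convex (minimizer T (theta_oo gamma)) &
      forall u, is_lower_projection mu T gamma u ->
        minimizer T (theta_oo gamma) u].
Proof.
move=> T0 cT Tconv; have projP u := lower_projectionP gamma u T0 cT Tconv.
split.
- have [u Tu umin] := least_excess gamma T0 cT Tconv.
  have ul : is_least T gamma u by [].
  exists u; split=> [|v /(_ 1 (lexx _))]; first exact/projP.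
  by rewrite (least_minimizer ul)// => ->.
- by move=> u /projP ul p; exact: least_minimizer.
- exact: minimizer_oo_compact.
- exact: minimizer_oo_lower_convex.
- by move=> u /projP; exact: least_theta_oo.
Qed.

(** * Upper projections by negation *)

Lemma lower_thetaN p gamma u :
  lower_theta mu p (- gamma) (- u) = upper_theta mu p gamma u.
Proof.
have hE : cls (- excess (u - gamma)) = - u - - gamma.
  by rewrite clsN cls_excess opprD.
rewrite (lower_thetaE mu p hE) (upper_thetaE mu p (cls_excess _)) BC_infN.
by congr (_ `^ _); apply: eq_Rintegral => x _; rewrite opprK addrC.
Qed.

Lemma minimizer_lower_thetaN T gamma p :
  minimizer (-%R @` T) (lower_theta mu p (- gamma)) =
  -%R @` minimizer T (upper_theta mu p gamma).
Proof. by apply: minimizerN => u; exact: lower_thetaN. Qed.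

Lemma lower_projectionN T gamma u :
  is_lower_projection mu (-%R @` T) (- gamma) u <->
  is_upper_projection mu T gamma (- u).
Proof.
split=> uproj p p1.
  by apply/image_oppTP; rewrite -minimizer_lower_thetaN; exact: uproj.
by rewrite minimizer_lower_thetaN; apply/image_oppTP; exact: uproj.
Qed.

Lemma compact_oppTP T : compact T -> compact (-%R @` T).
Proof.
move=> cT; apply: continuous_compact => //.
by apply: continuous_subspaceT; exact: opp_continuous.
Qed.

Lemma oppTPK T : -%R @` (-%R @` T) = T.
Proof. by apply/seteqP; split=> u; rewrite !image_oppTP opprK. Qed.

Lemma upper_projection_spec T gamma :
  T !=set0 -> compact T -> upper_convex T ->
  [/\ exists! u, is_upper_projection mu T gamma u,
      forall u, is_upper_projection mu T gamma u ->
        forall p : R, 1 <= p -> minimizer T (upper_theta mu p gamma) = [set u],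
      compact (minimizer T (theta_oo gamma)),
      upper_convex (minimizer T (theta_oo gamma)) &
      forall u, is_upper_projection mu T gamma u ->
        minimizer T (theta_oo gamma) u].
Proof.
move=> T0 cT Tconv.
(* The lower case is applied to the lower convex set [-T] and the point [- gamma]. *)
have [[u [uproj uuniq]] min1 _ _ minoo] := lower_projection_spec (- gamma)
  (image_nonempty _ T0) (compact_oppTP cT) (upper_convexN Tconv).
have projN v : is_upper_projection mu T gamma v ->
    is_lower_projection mu (-%R @` T) (- gamma) (- v).
  by move=> vproj; apply/lower_projectionN; rewrite opprK.
split.
- exists (- u); split=> [|v /projN /uuniq ->]; last by rewrite opprK.
  exact/lower_projectionN.
- move=> v /projN vproj p p1.
  rewrite -[LHS]oppTPK -minimizer_lower_thetaN (min1 _ vproj _ p1).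
  by rewrite image_set1 opprK.
- exact: minimizer_oo_compact.
- exact: minimizer_oo_upper_convex.
- move=> v /projN /minoo; rewrite (minimizerN _ (theta_ooN gamma)).
  by move=> /image_oppTP; rewrite opprK.
Qed.

(** The second hypothesis bounds the excess of [u - gamma] from below, once the norms of [u - gamma]
    and [w - gamma] are known to agree. *)
Lemma least_unique_minimizer T gamma u :
  is_least T gamma u -> is_least (-%R @` T) (- gamma) (- u) ->
  minimizer T (theta_oo gamma) = [set u].
Proof.
move=> ul [_ uNl]; apply/seteqP.
split=> [w [Tw wmin]|_ ->]; last exact: least_theta_oo.
have [Tu umin] := ul.
have norm_uw : `|u - gamma| = `|w - gamma|.
  by apply/eqP; rewrite eq_le (wmin u Tu) (proj2 (least_theta_oo ul)).
apply: (addIr (- gamma)); apply: (@excess_eq _ _ _ _ 0) => x.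
apply/eqP; rewrite subr_eq0 eq_le umin// andbT.
(* By [excessN], leastness of [- u] compares the two norms minus the excesses; cancelling the common
   norm reverses the inequality given by leastness of [u]. *)
have /uNl/(_ x) : (-%R @` T) (- w) by exists w.
by rewrite -!opprD !excessN norm_uw lerD2l lerN2.
Qed.

End Projections.

Theorem theorem4p6 (R : realType) (X : ptopologicalType)
    (X_hausdorff : hausdorff_space X)
    (X_locally_compact : locally_compact [set: X])
    (mu : {measure set (borel X) -> \bar R})
    (mu_gt0 : (0 < mu [set: X])%E)
    (mu_lty : (mu [set: X] < +oo)%E)
    (mu_null : trivial_null_set mu)
    (T : set (TP X R)) (T_neq0 : T !=set0) (T_compact : compact T) :
  [/\ lower_convex T -> forall gamma : TP X R,
        [/\ exists! u, is_lower_projection mu T gamma u,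
            forall u, is_lower_projection mu T gamma u ->
              forall p : R, 1 <= p ->
                minimizer T (lower_theta mu p gamma) = [set u],
            compact (minimizer T (theta_oo gamma)),
            lower_convex (minimizer T (theta_oo gamma)) &
            forall u, is_lower_projection mu T gamma u ->
              minimizer T (theta_oo gamma) u],
      upper_convex T -> forall gamma : TP X R,
        [/\ exists! u, is_upper_projection mu T gamma u,
            forall u, is_upper_projection mu T gamma u ->
              forall p : R, 1 <= p ->
                minimizer T (upper_theta mu p gamma) = [set u],
            compact (minimizer T (theta_oo gamma)),
            upper_convex (minimizer T (theta_oo gamma)) &
            forall u, is_upper_projection mu T gamma u ->
              minimizer T (theta_oo gamma) u] &
      lower_convex T -> upper_convex T -> forall gamma : TP X R,
        [/\ lower_convex (minimizer T (theta_oo gamma)),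
            upper_convex (minimizer T (theta_oo gamma)) &
            forall u v, is_lower_projection mu T gamma u ->
              is_upper_projection mu T gamma v ->
              (u = v <-> (minimizer T (theta_oo gamma) = [set u] /\
                          minimizer T (theta_oo gamma) = [set v]))]].
Proof.
split=> [Tl gamma|Tu gamma|Tl Tu gamma].
- exact: lower_projection_spec.
- exact: upper_projection_spec.
split; [exact: minimizer_oo_lower_convex|exact: minimizer_oo_upper_convex|].
move=> u v uproj vproj; split=> [uv|[-> uv]]; last first.
  by have : [set v] u by rewrite -uv.
(* Being both projections at once, [u] is least in [T] relative to [gamma], and [- u] is least in
   [-T] relative to [- gamma]. *)
rewrite -uv in vproj *; suff -> : minimizer T (theta_oo gamma) = [set u] by [].
apply: least_unique_minimizer; first exact/(lower_projectionP mu_lty mu_null).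
apply/(lower_projectionP mu_lty mu_null).
- exact: image_nonempty.
- exact: compact_oppTP.
- exact: upper_convexN.
- by apply/lower_projectionN; rewrite opprK.
Qed.
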